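(* Let $\mathcal{H}$ be a separable Hilbert space, let $\rho$ be a state in $\mathfrak{S}_{\mathsf{FA}}(\mathcal{H})$ and let $\rho_r=P_r\rho/[\mathrm{Tr}\,P_r\rho]$, where $P_r$ is the spectral projector of $\rho$ corresponding to its $r$ maximal eigenvalues. Let $C,T,D$ be nonnegative numbers. Then there is a natural number $r_0$ and a vanishing sequence $\{Y_{C,T,D}(r)\}_{r\in\mathbb{N}}$ (depending only on the spectrum of $\rho$ and the numbers $C,T$ and $D$) such that $$|f(\rho_r)-f(\rho)|\leq Y_{C,T,D}(r)\qquad\forall r\geq r_0$$ for any function $f$ in the class $L(C,T,D)$.
   Context: A state on $\mathcal{H}$ is a positive trace-class operator with unit trace; $\mathfrak{S}(\mathcal{H})$ is the set of all states. $\{\lambda^{\rho}_i\}_{i\ge1}$ denotes the non-increasing sequence of eigenvalues of $\rho$ counted with multiplicity (the positive eigenvalues, followed by zeros if $\rho$ has finite rank). FA-property: it holds for a state $\rho$ if there is a sequence $\{g_i\}_{i\ge1}$ of nonnegative numbers such that $\sum_{i=1}^{+\infty}\lambda^{\rho}_i g_i<+\infty$ and $\lim_{\beta\to0^+}\left[\sum_{i=1}^{+\infty}e^{-\beta g_i}\right]^{\beta}=1$. The set of states with the FA-property is $\mathfrak{S}_{\mathsf{FA}}(\mathcal{H})$; any such state has finite von Neumann entropy. Projector $P_r$: for a spectral decomposition $\rho=\sum_i\lambda^{\rho}_i|\varphi_i\rangle\langle\varphi_i|$ (with $\{\varphi_i\}$ orthonormal), $P_r=\sum_{i=1}^r|\varphi_i\rangle\langle\varphi_i|$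 (multiplicity is taken into account). $H(\rho)=-\mathrm{Tr}\,\rho\log\rho$ is the von Neumann entropy and $h_2(p)=-p\log p-(1-p)\log(1-p)$ is the binary entropy. Class $L(C,T,D)$: the set of all (real-valued) functions $f$ on $\mathfrak{S}_0(\mathcal{H})=\{\rho\in\mathfrak{S}(\mathcal{H})\,|\,H(\rho)<+\infty\}$ for which there are nonnegative numbers $a_f,b_f,c^{\pm}_f,t^{\pm}_f$ with $a_f+b_f=D$, $c^-_f+c^+_f=C$, $t^-_f+t^+_f=T$ such that $$-a_fh_2(p)\leq f(p\rho+(1-p)\sigma)-pf(\rho)-(1-p)f(\sigma)\leq b_fh_2(p)$$ for any $\rho,\sigma\in\mathfrak{S}_0(\mathcal{H})$ and $p\in(0,1)$, and $$-c^-_fH(\rho)-t^-_f\leq f(\rho)\leq c^+_fH(\rho)+t^+_f$$ for any $\rho\in\mathfrak{S}_0(\mathcal{H})$. ''Vanishing sequence'' means a sequence tending to $0$ as $r\to+\infty$. *)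

(* Defs.v *)
From HB Require Import structures.
From mathcomp Require Import all_boot all_order all_algebra.
From mathcomp Require Import sesquilinear complex.
From mathcomp Require Import all_classical all_reals all_analysis.

Set Implicit Arguments.
Unset Strict Implicit.
Unset Printing Implicit Defensive.
Import Order.TTheory GRing.Theory Num.Theory.
Import numFieldNormedType.Exports.
Local Open Scope classical_set_scope.
Local Open Scope complex_scope.
Local Open Scope ring_scope.

(* The inner product is linear in its FIRST argument, as all forms of
   sesquilinear.v: the bracket <x|y> of physics is [hdot y x]. *)
HB.mixin Record CompleteNormedModule_isHilbert (R : realType) (H : Type)
    of CompleteNormedModule R[i] H := {
  hdot : {dot H for (@Num.conj R[i])} ;
  hdotxx : forall x : H, hdot x x = `|x| ^+ 2 }.

#[short(type="hilbertType")]
HB.structure Definition Hilbert (R : realType) :=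
  {H of CompleteNormedModule R[i] H & CompleteNormedModule_isHilbert R H}.

Definition separable (T : topologicalType) : Prop :=
  exists2 S : set T, countable S & dense S.

Section Operators.
Variables (R : realType) (H : hilbertType R).
Implicit Types (A : H -> H) (lambda : nat -> R) (phi : nat -> H).

Definition orthonormal_basis (B : set H) : Prop :=
  (forall e e', B e -> B e' -> hdot e e' = (e == e')%:R) /\
  (forall x : H, (forall e, B e -> hdot x e = 0) -> x = 0).

(* Trace of a positive operator, in [0, +oo]; the value does not depend on the
   chosen basis, and a bounded positive A is trace class iff it is finite. *)
Definition trace A : \bar R :=
  (\esum_(e in xget set0 orthonormal_basis) (complex.Re (hdot (A e) e))%:E)%E.

(* In R[i], 0 <= z means that z is real and nonnegative. *)
Definition positive_operator A : Prop :=
  [/\ linear A, continuous A & forall x, 0 <= hdot (A x) x].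

Definition state A : Prop := positive_operator A /\ trace A = 1%E.

(* A = sum_i lambda_i |phi_i><phi_i|, with (phi_i) orthonormal, where phi may be
   padded with null vectors at indices i such that lambda_i = 0 (unavoidable when
   H is finite dimensional).  The order of the lambda_i is not prescribed. *)
Definition spectral_decomposition A lambda phi : Prop :=
  [/\ forall i, 0 <= lambda i,
      forall i j, i != j -> hdot (phi i) (phi j) = 0,
      forall i, hdot (phi i) (phi i) = 1 \/ (phi i = 0 /\ lambda i = 0)
    & forall x, series (fun i => ((lambda i)%:C * hdot x (phi i)) *: phi i) @ \oo
                  --> A x].

(* g(A) = sum_i g(lambda_i) |phi_i><phi_i| for g with g 0 = 0 *)
Definition functional_calculus (g : R -> R) A : H -> H :=
  let d := xget (fun=> 0, fun=> 0)
             [set d | spectral_decomposition A d.1 d.2] in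
  fun x => limn (series (fun i => ((g (d.1 i))%:C * hdot x (d.2 i)) *: d.2 i)).

(* - x log x; ln 0 = 0, so that eta 0 = 0 *)
Definition eta (x : R) : R := - (x * ln x).

Definition entropy A : \bar R := trace (functional_calculus eta A).

Definition finite_entropy_state A : Prop := state A /\ (entropy A < +oo)%E.

(* Each a > 0 occurs in lambda as many times as the dimension of ker (A - a). *)
Definition is_eigenvalue_sequence A lambda : Prop :=
  [/\ forall i, 0 <= lambda i,
      nonincreasing_seq lambda
    & forall a, 0 < a -> exists n (e : 'I_n -> H),
        [/\ ([set i | lambda i = a] #= `I_n)%card,
            forall j k, hdot (e j) (e k) = (j == k)%:R
          & forall x, A x = a%:C *: x <->
                      x = \sum_(j < n) hdot x (e j) *: e j]].

Definition eigenvalues A : nat -> R :=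
  xget (fun=> 0) [set lambda | is_eigenvalue_sequence A lambda].

Definition FA_property A : Prop :=
  exists g : nat -> R,
    [/\ forall i, 0 <= g i,
        (\sum_(0 <= i <oo) (eigenvalues A i * g i)%:E < +oo)%E
      & (fun beta : R =>
           poweR (\sum_(0 <= i <oo) (expR (- (beta * g i)))%:E)%E beta)
          @ 0^'+ --> 1%E].

Definition FA_state A : Prop := state A /\ FA_property A.

(* If phi has null padding vectors, this may be a smaller projector P than the
   one onto r eigenvectors, but P \o A is the same. *)
Definition projector phi (r : nat) : H -> H :=
  fun x => \sum_(i < r) hdot x (phi i) *: phi i.

Definition truncation A phi (r : nat) : H -> H :=
  ((fine (trace (projector phi r \o A)))^-1)%:C *: (projector phi r \o A).

Definition mixture (p : R) (A B : H -> H) : H -> H :=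
  p%:C *: A + (1 - p)%:C *: B.

Definition binary_entropy (p : R) : R := eta p + eta (1 - p).

(* A function on the states of finite entropy is represented by a function on all
   maps H -> H, whose other values are irrelevant. *)
Definition class_L (C T D : R) (f : (H -> H) -> R) : Prop :=
  exists a b cm cp tm tp : R,
    [/\ [/\ 0 <= a, 0 <= b, 0 <= cm & 0 <= cp],
        0 <= tm /\ 0 <= tp,
        [/\ a + b = D, cm + cp = C & tm + tp = T],
        forall rho sigma p,
          finite_entropy_state rho -> finite_entropy_state sigma ->
          0 < p < 1 ->
          - (a * binary_entropy p)
            <= f (mixture p rho sigma) - p * f rho - (1 - p) * f sigma
            <= b * binary_entropy p
      & forall rho, finite_entropy_state rho ->
          - (cm * fine (entropy rho)) - tm <= f rho
            <= cp * fine (entropy rho) + tp].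

End Operators.

(* Main.v *)
(* With c_r the sum of the first r eigenvalues, rho is the mixture of weight c_r
   of its truncation rho_r and of the normalized tail sigma_r, so approximate
   affinity gives
     |f(rho_r) - f(rho)| <= D h_2(c_r) + (1 - c_r) (|f(rho_r)| + |f(sigma_r)|).
   The entropies satisfy H(rho_r) <= S / c_r and
   (1 - c_r) H(sigma_r) <= S - S_r, where S_r is the sum over i < r of
   - lambda_i log lambda_i and S = H(rho) its limit; hence the right-hand side is
   at most D h_2(c_r) + 2 T (1 - c_r) + C ((1 - c_r) S / c_r + S - S_r).
   The FA-property only enters through S < +oo, which is Gibbs' inequality
   against the weights exp(- beta g_i). *)

Require Import Defs.
From mathcomp Require Import all_boot all_order all_algebra.
From mathcomp Require Import sesquilinear complex.
From mathcomp Require Import all_classical all_reals all_analysis.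
From mathcomp Require Import ring lra.
Import Order.TTheory GRing.Theory Num.Theory.
Import numFieldNormedType.Exports.
Set Implicit Arguments.
Unset Strict Implicit.
Unset Printing Implicit Defensive.
Local Open Scope classical_set_scope.
Local Open Scope ring_scope.
Local Open Scope complex_scope.

(** * Squared modulus of complex numbers *)

Section SquaredModulus.
Variable R : rcfType.
Implicit Types z : R[i].

(** The norm of [R[i]] has values in [R[i]]; a squared modulus with values in [R] lets estimates and
    limits take place in the ordered real field, without square roots. *)
Definition sqmod z : R := complex.Re z ^+ 2 + complex.Im z ^+ 2.

Lemma sqmod_ge0 z : 0 <= sqmod z.
Proof. by rewrite addr_ge0 ?sqr_ge0. Qed.

Lemma mul_conj_sqmod z : z * Num.conj z = (sqmod z)%:C.
Proof. by rewrite add_Re2_Im2 normCK. Qed.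

Lemma sqmodM z1 z2 : sqmod (z1 * z2) = sqmod z1 * sqmod z2.
Proof. by case: z1 z2 => a b [c d]; rewrite /sqmod /=; ring. Qed.

Lemma sqmod_real (a : R) : sqmod a%:C = a ^+ 2.
Proof. by rewrite /sqmod /= expr0n addr0. Qed.

Lemma sqmod_conj z : sqmod (Num.conj z) = sqmod z.
Proof. by apply: complexI; rewrite -!mul_conj_sqmod conjCK mulrC. Qed.

(** The difference of the two sides is the squared modulus of [z1 - z2]. With [normsqD_le], this
    replaces the triangle inequality throughout. *)
Lemma sqmodD_le z1 z2 : sqmod (z1 + z2) <= sqmod z1 *+ 2 + sqmod z2 *+ 2.
Proof.
case: z1 z2 => a b [c d]; rewrite /sqmod /= -subr_ge0.
by rewrite [leRHS](_ : _ = (a - c) ^+ 2 + (b - d) ^+ 2) ?addr_ge0 ?sqr_ge0//; ring.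
Qed.

Lemma sqmod0 : sqmod (0 : R[i]) = 0.
Proof. by rewrite /sqmod /= expr0n addr0. Qed.

Lemma sqmod_eq0 z : (sqmod z == 0) = (z == 0).
Proof.
case: z => a b; rewrite /sqmod /= paddr_eq0 ?sqr_ge0// !sqrf_eq0.
by rewrite eq_complex.
Qed.

End SquaredModulus.

(** * Inner product, Cauchy-Schwarz inequality, convergence through squared norms *)

Section InnerProduct.
Variables (R : realType) (H : hilbertType R).
Implicit Types x y z : H.

Definition normsq x : R := complex.Re (hdot x x).

Lemma hdot_conj x y : hdot x y = Num.conj (hdot y x).
Proof. by rewrite (hermC hdot x y) expr0 mul1r. Qed.

Lemma sqmod_hdotC x y : sqmod (hdot x y) = sqmod (hdot y x).
Proof. by rewrite hdot_conj sqmod_conj. Qed.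

Lemma hdot_normsq x : hdot x x = (normsq x)%:C.
Proof.
rewrite /normsq; have := dnorm_ge0 hdot x.
by case: (hdot x x) => a b /ger0_Im /= ->.
Qed.

Lemma normsq_ge0 x : 0 <= normsq x.
Proof. by rewrite -ler0c -hdot_normsq dnorm_ge0. Qed.

Lemma normsq0 : normsq 0 = 0.
Proof. by rewrite /normsq linear0l. Qed.

Lemma normsq_eq0 x : (normsq x == 0) = (x == 0).
Proof. by rewrite -(dnorm_eq0 hdot) hdot_normsq eq_complex /= eqxx andbT. Qed.

Lemma normsqN x : normsq (- x) = normsq x.
Proof. by rewrite /normsq (hnormN hdot). Qed.

Lemma normsqZ a x : normsq (a *: x) = sqmod a * normsq x.
Proof.
apply: complexI; rewrite -hdot_normsq (dnormZ hdot) hdot_normsq.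
by rewrite -add_Re2_Im2 -rmorphM.
Qed.

Lemma normsqD x y :
  normsq (x + y) = normsq x + normsq y + complex.Re (hdot x y) *+ 2.
Proof.
rewrite /normsq (dnormD hdot).
have ReJ (z : R[i]) : complex.Re (z + Num.conj z) = complex.Re z *+ 2.
  by case: z => a b; rewrite mulr2n.
by rewrite -ReJ; case: (hdot x x) (hdot y y) (_ + Num.conj _) => a b [c d] [].
Qed.

Lemma normsqB x y :
  normsq (x - y) = normsq x + normsq y - complex.Re (hdot x y) *+ 2.
Proof.
have ReN (z : R[i]) : complex.Re (- z) = - complex.Re z by case: z.
by rewrite normsqD normsqN linearNr ReN mulNrn.
Qed.

Lemma normsqD_orth x y : hdot x y = 0 -> normsq (x + y) = normsq x + normsq y.
Proof. by rewrite normsqD => -> /=; rewrite mul0rn addr0. Qed.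

Lemma normsqD_le x y : normsq (x + y) <= normsq x *+ 2 + normsq y *+ 2.
Proof. have := normsq_ge0 (x - y); rewrite normsqB normsqD; lra. Qed.

Lemma hdotZl a x y : hdot (a *: x) y = a * hdot x y.
Proof. exact: linearZl_LR. Qed.

Lemma hdotZr a x y : hdot x (a *: y) = Num.conj a * hdot x y.
Proof. by rewrite hdot_conj hdotZl rmorphM (hdot_conj x y). Qed.

Lemma hdot0r x : hdot x 0 = 0.
Proof. exact: linear0r. Qed.

Lemma hdotDl x y z : hdot (x + y) z = hdot x z + hdot y z.
Proof. exact: linearDl. Qed.

Lemma hdotBl x y z : hdot (x - y) z = hdot x z - hdot y z.
Proof. exact: linearBl. Qed.

Lemma hdotBr x y z : hdot x (y - z) = hdot x y - hdot x z.
Proof. exact: linearBr. Qed.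

(** The squared norm of $\|y\|^2 x - \langle x, y\rangle y$ equals $\|y\|^2 (\|x\|^2\|y\|^2 -
    |\langle x, y\rangle|^2)$ and is nonnegative. *)
Lemma CauchySchwarz_sqmod x y : sqmod (hdot x y) <= normsq x * normsq y.
Proof.
have [->|y0] := eqVneq y 0.
  by rewrite hdot0r normsq0 mulr0 sqmod0.
have N0 : 0 < normsq y by rewrite lt_neqAle normsq_ge0 eq_sym normsq_eq0 y0.
have := normsq_ge0 ((normsq y)%:C *: x - hdot x y *: y).
rewrite normsqB !normsqZ sqmod_real hdotZl hdotZr (mulrC _^*) mul_conj_sqmod.
rewrite -rmorphM /= => h; rewrite -subr_ge0 -(pmulr_rge0 _ N0).
by move: h; set N := normsq y; lra.
Qed.

Lemma normr_lt_normsq x (e : R) : 0 < e -> (`|x| < e%:C) = (normsq x < e ^+ 2).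
Proof.
move=> e0; rewrite -(ltr_pXn2r (ltn0Sn 1)) ?nnegrE ?normr_ge0 ?ler0c ?ltW//.
by rewrite -hdotxx hdot_normsq -rmorphXn /= ltcR.
Qed.

Lemma cvg_normsqP (u : nat -> H) x :
  u @ \oo --> x <-> normsq (x - u n) @[n --> \oo] --> (0 : R).
Proof.
split.
  move=> /cvgrPdist_lt ux; apply/cvgrPdist_lt => e e0.
  have se0 : 0 < Num.sqrt e by rewrite sqrtr_gt0.
  have /ux : 0 < (Num.sqrt e)%:C by rewrite ltcR.
  apply: filterS => n; rewrite normr_lt_normsq// sqr_sqrtr 1?ltW//.
  by rewrite sub0r normrN ger0_norm ?normsq_ge0.
move=> /cvgrPdist_lt ux; apply/cvgrPdist_lt => -[e e'].
rewrite ltcE /= => /andP[/eqP-> e0].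
have /ux : 0 < e ^+ 2 by rewrite exprn_gt0.
apply: filterS => n.
by rewrite sub0r normrN ger0_norm ?normsq_ge0// -normr_lt_normsq.
Qed.

Lemma cauchy_normsq (u : nat -> H) (e : nat -> R) :
  (forall m n, normsq (u m - u n) <= e m + e n) -> e @ \oo --> (0 : R) ->
  cvgn u.
Proof.
move=> ue e0; apply/cauchy_cvgP/cauchy_ballP => -[d d'].
rewrite ltcE /= => /andP[/eqP-> d0].
have d20 : 0 < d ^+ 2 / 2 by rewrite divr_gt0 ?exprn_gt0.
move/cvgrPdist_lt : e0 => /(_ _ d20) e0.
(* Both members of the pair are the image of the indices where [e] is below half of [d ^+ 2]; two
   such points have squared distance below [d ^+ 2]. *)
exists (u @` [set n | `|0 - e n| < d ^+ 2 / 2], u @` [set n | `|0 - e n| < d ^+ 2 / 2]).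
  by split => /=; apply: filterS e0 => n /= en; exists n.
case=> _ _ [[m em <-] [n en <-]] /=.
rewrite -ball_normE /= normr_lt_normsq//; apply: le_lt_trans (ue _ _) _.
move: em en; rewrite /= !sub0r !normrN; have := ler_norm (e m).
by have := ler_norm (e n); lra.
Qed.

End InnerProduct.
(** Its main use is to show that a nonnegative constant is zero, by bounding it by a null sequence
    of approximation errors. *)
Lemma cvg0_ge (R : realType) (d : nat -> R) (a : R) :
  (\forall n \near \oo, a <= d n) -> d @ \oo --> (0 : R) -> a <= 0.
Proof.
move=> ad d0; rewrite -(cvg_lim _ d0)//; apply: limr_ge => //.
by apply/cvg_ex; exists 0.
Qed.

(** * Bessel inequality and Parseval identity *)

Section OrthonormalSystem.
Variables (R : realType) (H : hilbertType R) (I : choiceType).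
Implicit Types (P : set I) (v : I -> H) (x : H) (s : seq I).

(* Null vectors are allowed, to account for the padding of finite systems. *)
Definition orthosystem P v : Prop :=
  (forall i j, P i -> P j -> i != j -> hdot (v i) (v j) = 0) /\
  (forall i, P i -> hdot (v i) (v i) = 1 \/ v i = 0).

Definition coef v x i : R := sqmod (hdot x (v i)).

Definition expansion v x s : H := \sum_(i <- s) hdot x (v i) *: v i.

Lemma coef_ge0 v x i : 0 <= coef v x i.
Proof. exact: sqmod_ge0. Qed.

Lemma hdot_suml s (c : I -> R[i]) v x :
  hdot (\sum_(i <- s) c i *: v i) x = \sum_(i <- s) c i * hdot (v i) x.
Proof. by rewrite linear_sumlz; apply: eq_bigr => i _; exact: hdotZl. Qed.

Lemma hdot_sumr s (c : I -> R[i]) v x :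
  hdot x (\sum_(i <- s) c i *: v i) =
  \sum_(i <- s) Num.conj (c i) * hdot x (v i).
Proof. by rewrite linear_sumr; apply: eq_bigr => i _; exact: hdotZr. Qed.

Variables (P : set I) (v : I -> H).
Hypothesis vP : orthosystem P v.

(** Either [v i] is a unit vector, or it is null and the coefficient is already 0. *)
Lemma coef_norm x i : P i -> coef v x i * normsq (v i) = coef v x i.
Proof.
rewrite /coef => /(proj2 vP)[vi1|->]; first by rewrite /normsq vi1 mulr1.
by rewrite normsq0 mulr0 hdot0r sqmod0.
Qed.

Lemma hdot_orthosystem x i : P i -> hdot x (v i) * hdot (v i) (v i) = hdot x (v i).
Proof.
by case/(proj2 vP) => [->|->]; [rewrite mulr1|rewrite hdot0r mul0r].
Qed.

Lemma normsq_orthosystem_le1 i : P i -> normsq (v i) <= 1.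
Proof.
by case/(proj2 vP) => [vi1|->]; rewrite ?normsq0 ?ler01// /normsq vi1.
Qed.

Lemma hdot_sum_orthosystem s c i :
  uniq s -> (forall j, j \in s -> P j) -> i \in s ->
  hdot (\sum_(j <- s) c j *: v j) (v i) = c i * hdot (v i) (v i).
Proof.
move=> us sP si; rewrite hdot_suml (bigD1_seq i)//= big_seq_cond big1 ?addr0//.
by move=> j /andP[sj ji]; rewrite (proj1 vP) ?mulr0//; exact: sP.
Qed.

Lemma normsq_sum_orthosystem s c :
  uniq s -> (forall j, j \in s -> P j) ->
  normsq (\sum_(j <- s) c j *: v j) = \sum_(j <- s) sqmod (c j) * normsq (v j).
Proof.
elim: s => [|i s IHs] /=; first by rewrite !big_nil normsq0.
move=> /andP[si us] sP; rewrite !big_cons normsqD_orth; last first.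
  rewrite hdotZl hdot_sumr big_seq big1 ?mulr0// => j sj.
  have ij : i != j by apply: contraNneq si => ->.
  by rewrite (proj1 vP _ _ _ _ ij) ?mulr0//; apply: sP; rewrite inE ?eqxx ?sj ?orbT.
by rewrite normsqZ IHs// => j sj; apply: sP; rewrite inE sj orbT.
Qed.

Section FiniteExpansion.
Variables (s : seq I).
Hypotheses (us : uniq s) (sP : forall i, i \in s -> P i).

Lemma normsq_expansion_weighted x (k : I -> R) :
  normsq (\sum_(i <- s) ((k i)%:C * hdot x (v i)) *: v i) =
  \sum_(i <- s) k i ^+ 2 * coef v x i.
Proof.
rewrite (normsq_sum_orthosystem _ us sP) !big_seq; apply: eq_bigr => i si.
by rewrite sqmodM sqmod_real -mulrA -/(coef v x i) coef_norm//; exact: sP.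
Qed.

Lemma normsq_expansion x : normsq (expansion v x s) = \sum_(i <- s) coef v x i.
Proof.
rewrite (normsq_sum_orthosystem _ us sP) !big_seq; apply: eq_bigr => i si.
by rewrite -/(coef v x i) coef_norm//; exact: sP.
Qed.

Lemma hdot_expansion_residual x i :
  i \in s -> hdot (x - expansion v x s) (v i) = 0.
Proof.
move=> si; rewrite /expansion hdotBl hdot_sum_orthosystem// hdot_orthosystem ?subrr//.
exact: sP.
Qed.

Lemma normsq_residual x :
  normsq (x - expansion v x s) = normsq x - \sum_(i <- s) coef v x i.
Proof.
rewrite normsqB normsq_expansion hdot_sumr.
under [in complex.Re _]eq_bigr => i _ do rewrite mulrC mul_conj_sqmod.
by rewrite -rmorph_sum /= mulr2n opprD addrACA subrr addr0.
Qed.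

Lemma Bessel_seq x : \sum_(i <- s) coef v x i <= normsq x.
Proof. by rewrite -subr_ge0 -normsq_residual normsq_ge0. Qed.

(** Pythagoras: the residual over the larger support is orthogonal to every [v i] with [i] in [s],
    hence to the difference of the two expansions. *)
Lemma normsq_expansionB x s' : {subset s' <= s} ->
  normsq (x - expansion v x s') =
  normsq (x - expansion v x s) + normsq (expansion v x s - expansion v x s').
Proof.
move=> s's; rewrite -normsqD_orth ?subrKA//.
rewrite hdotBr {2 4}/expansion !hdot_sumr.
by rewrite !big_seq !big1 ?subrr// => i si;
   rewrite hdot_expansion_residual ?mulr0// s's.
Qed.

End FiniteExpansion.

Lemma Bessel x : (\esum_(i in P) (coef v x i)%:E <= (normsq x)%:E)%E.
Proof.
apply: ub_ereal_sup => _ [X [finX XP] <-].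
rewrite fsbig_finite//= sumEFin lee_fin Bessel_seq// => i.
by rewrite in_fset_set// inE; exact: XP.
Qed.

(** [P] may be uncountable, so the sum [S], finite by Bessel, is approached along finite supports
    [s n] with defect [e n]. The expansions over [s n] form a Cauchy sequence whose limit [y] has
    the same coefficients as [x], so that [x = y] by completeness. The residuals then tend to 0,
    while their squared norms are at least [normsq x - S]. *)
Lemma Parseval x :
  (forall y, (forall i, P i -> hdot y (v i) = 0) -> y = 0) ->
  (\esum_(i in P) (coef v x i)%:E = (normsq x)%:E)%E.
Proof.
move=> complP.
have : (\esum_(i in P) (coef v x i)%:E)%E \is a fin_num.
  rewrite ge0_fin_numE ?(le_lt_trans (Bessel x)) ?ltry// esum_ge0// => i _.
  by rewrite lee_fin coef_ge0.
move=> /fineK; set S := fine _ => SE; rewrite -SE.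
have sumS s : uniq s -> (forall i, i \in s -> P i) ->
    \sum_(i <- s) coef v x i <= S.
  move=> us sP; rewrite -lee_fin SE; apply: esum_ge.
  exists [set` s]; first by split => //=; exact: finite_seq.
  by rewrite -fsbig_seq// sumEFin.
have exs (e : R) : 0 < e -> exists s, [/\ uniq s, forall i, i \in s -> P i &
    S - e < \sum_(i <- s) coef v x i].
  move=> e0.
  have Sfin : (\esum_(i in P) (coef v x i)%:E)%E \is a fin_num by rewrite -SE.
  have [_ [X [finX XP] <-]] := ub_ereal_sup_adherent e0 Sfin.
  rewrite -/(esum _ _) -SE fsbig_finite//= sumEFin -EFinB lte_fin => lt.
  exists (finmap.enum_fset (fset_set X)); split => // i; rewrite in_fset_set// inE; exact: XP.
have /choice[s sP] n : exists s, [/\ uniq s, forall i, i \in s -> P i &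
    S - n.+1%:R^-1 < \sum_(i <- s) coef v x i] by apply: exs; rewrite invr_gt0.
pose e n : R := S - \sum_(i <- s n) coef v x i.
have e_ge0 n : 0 <= e n by rewrite subr_ge0; have [us sP' _] := sP n; exact: sumS.
have e0 : e @ \oo --> (0 : R).
  apply: (@squeeze_cvgr _ _ _ _ (fun=> 0) (@harmonic R)).
  - near=> n; rewrite e_ge0 /=.
    by have [_ _ h] := sP n; rewrite lerBlDr -lerBlDl ltW.
  - exact: cvg_cst.
  - exact: cvg_harmonic.
(* By Pythagoras this squared norm is the increase of the partial sum from [s n] to [s'], at most
   [S] minus the sum over [s n]. *)
have resid n s' : uniq s' -> (forall i, i \in s' -> P i) ->
    {subset s n <= s'} -> 
    normsq (expansion v x s' - expansion v x (s n)) <= e n.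
  move=> us' s'P ss'; have [us sP' _] := sP n.
  have := normsq_expansionB us' s'P x ss'; rewrite !normsq_residual//.
  by have := sumS _ us' s'P; rewrite /e; lra.
(* Two expansions are compared through the one over the union of their supports. *)
have /cvg_ex[y yP] : cvgn (fun n => expansion v x (s n)).
  apply: (@cauchy_normsq _ _ _ (fun n => e n *+ 2)); last first.
    by rewrite -[0 : R](mul0rn _ 2); exact: cvgMn.
  move=> m n; have [us sPm _] := sP m; have [un sPn _] := sP n.
  have uu := undup_uniq (s m ++ s n).
  have uP i : i \in undup (s m ++ s n) -> P i.
    by rewrite mem_undup mem_cat => /orP[/sPm|/sPn].
  set t := expansion v x (undup (s m ++ s n)).
  have -> : expansion v x (s m) - expansion v x (s n) =
    (t - expansion v x (s n)) + - (t - expansion v x (s m)).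
    by rewrite opprB [RHS]addrC subrKA.
  apply: le_trans (normsqD_le _ _) _; rewrite normsqN addrC.
  by apply: lerD; rewrite lerMn2r resid// => i; rewrite mem_undup mem_cat => ->;
    rewrite ?orbT.
(* For [i] outside [s n], adjoining [i] keeps the sum below [S], so the coefficient fits into the
   defect [e n]. *)
have small n i : P i -> coef v (x - expansion v x (s n)) i <= e n.
  move=> Pi; have [us sPn _] := sP n; rewrite /coef.
  have [si|si] := boolP (i \in s n).
    by rewrite hdot_expansion_residual// sqmod0.
  rewrite /expansion hdotBl hdot_suml big_seq big1 ?subr0; last first.
    move=> j sj; rewrite (proj1 vP) ?mulr0//; first exact: sPn.
    by apply: contraNneq si => <-.
  rewrite -/(coef v x i) lerBrDr -(big_cons _ _ _ _ xpredT) sumS//=.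
    by rewrite si.
  by move=> j; rewrite inE => /predU1P[->//|/sPn].
(* The difference [x - y] is split at the n-th expansion: [small] controls the first part and
   Cauchy-Schwarz the second. *)
have xy : x = y.
  apply/subr0_eq/complP => i Pi; apply/eqP; rewrite -sqmod_eq0 eq_le sqmod_ge0.
  rewrite andbT; apply: (@cvg0_ge _ (fun n =>
    e n *+ 2 + normsq (y - expansion v x (s n)) *+ 2)); last first.
    rewrite -[0 : R](mul0rn _ 2) -[X in _ --> X]addr0 -{2}(mul0rn R 2).
    by apply: cvgD; apply: cvgMn => //; exact/cvg_normsqP.
  apply: nearW => n; rewrite (_ : x - y = (x - expansion v x (s n)) +
    - (y - expansion v x (s n))); last by rewrite opprB subrKA.
  rewrite hdotDl; apply: le_trans (sqmodD_le _ _) _.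
  apply: lerD; rewrite lerMn2r//; first exact: small.
  apply: le_trans (CauchySchwarz_sqmod _ _) _; rewrite normsqN.
  by rewrite ler_piMr ?normsq_ge0 ?normsq_orthosystem_le1.
congr _%:E; apply/eqP; rewrite eq_le -lee_fin SE Bessel /=.
rewrite -subr_le0; apply: (cvg0_ge (d := fun n => normsq (x - expansion v x (s n)))).
  apply: nearW => n; have [us sPn _] := sP n; rewrite normsq_residual//.
  by have := sumS _ us sPn; lra.
by rewrite {1}xy; exact/cvg_normsqP.
Unshelve. all: by end_near. Qed.

End OrthonormalSystem.

(** Since $k_i^2 \le 1$, two partial sums with [n <= m] have squared distance at most [s m - s n],
    and [s] converges, being nondecreasing and bounded by Bessel. *)
Lemma is_cvg_orthogonal_series (R : realType) (H : hilbertType R)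
    (v : nat -> H) (x : H) (k : nat -> R) :
  orthosystem setT v -> (forall i, 0 <= k i <= 1) ->
  cvgn (series (fun i => ((k i)%:C * hdot x (v i)) *: v i)).
Proof.
move=> vT k01; pose s n : R := \sum_(0 <= i < n) coef v x i.
have s_nd : nondecreasing_seq s.
  apply/nondecreasing_seqP => n; rewrite /s big_nat_recr//= lerDl.
  exact: coef_ge0.
have [l sl] : exists l : R, s @ \oo --> l.
  apply/cvg_ex; apply: nondecreasing_is_cvgn => //; exists (normsq x) => _ [n _ <-].
  by apply: (Bessel_seq vT) => //; exact: iota_uniq.
have s_le n : s n <= l.
  by rewrite -(cvg_lim _ sl)//; apply: nondecreasing_cvgn_le => //; apply/cvg_ex; exists l.
apply: (@cauchy_normsq _ _ _ (fun n => l - s n)); last first.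
  by rewrite -(subrr l); apply: cvgB => //; exact: cvg_cst.
move=> m n; wlog mn : m n / (n <= m)%N => [hw|].
  have [|/ltnW] := leqP n m; first exact: hw.
  by rewrite -normsqN opprB (addrC (l - s m)); exact: hw.
rewrite sub_series_geq// (normsq_expansion_weighted vT) ?iota_uniq//.
apply: (@le_trans _ _ (s m - s n)); last first.
  by have := s_le m; lra.
rewrite /s (@big_cat_nat _ _ _ n 0 m)//= addrAC subrr add0r.
apply: ler_sum => i _; have /andP[k0 k1] := k01 i.
by rewrite ler_piMl ?coef_ge0// expr_le1.
Qed.

(** * Exchange and scaling of sums of nonnegative families *)

Lemma esum_exchange (R : realType) (T1 T2 : choiceType) (I : set T1) (J : set T2)
    (a : T1 -> T2 -> \bar R) :
  (forall i j, (0 <= a i j)%E) ->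
  (\esum_(i in I) \esum_(j in J) a i j = \esum_(j in J) \esum_(i in I) a i j)%E.
Proof.
move=> a0; rewrite !esum_esum//.
rewrite (@reindex_esum _ _ _ (J `*`` fun=> I) (I `*`` fun=> J) (fun k => (k.2, k.1)))//.
split.
- by move=> [i j] [/= Ji Ij]; split.
- by move=> [i j] [i' j'] _ _ [-> ->].
- by move=> [i j] [/= Ii Jj]; exists (j, i).
Qed.

Lemma le_esumZl (R : realType) (T : choiceType) (I : set T) (k : R) (a : T -> \bar R) :
  0 <= k -> (forall i, (0 <= a i)%E) ->
  (\esum_(i in I) (k%:E * a i) <= k%:E * \esum_(i in I) a i)%E.
Proof.
move=> k0 a0; apply: ub_ereal_sup => _ [X [finX XI] <-].
rewrite fsbig_finite//= -ge0_sume_distrr//.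
apply: lee_pmul => //; first by rewrite sume_ge0.
by apply: esum_ge; exists X => //; rewrite fsbig_finite.
Qed.

(** The converse of [le_esumZl] is [le_esumZl] itself for the factor [k^-1]. *)
Lemma esumZl (R : realType) (T : choiceType) (I : set T) (k : R) (a : T -> \bar R) :
  0 <= k -> (forall i, (0 <= a i)%E) ->
  (\esum_(i in I) (k%:E * a i) = k%:E * \esum_(i in I) a i)%E.
Proof.
move=> k0 a0; apply/eqP; rewrite eq_le le_esumZl//=.
have [->|kn0] := eqVneq k 0.
  by rewrite mul0e esum_ge0// => i _; rewrite mul0e.
have kp : 0 < k by rewrite lt_neqAle eq_sym kn0.
rewrite -lee_pdivlMl//.
rewrite [leLHS](_ : _ = \esum_(i in I) (k^-1%:E * (k%:E * a i)))%E; last first.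
  by apply: eq_esum => i _; rewrite muleA -EFinM mulVf// mul1e.
by apply: le_esumZl; rewrite ?invr_ge0// => i; rewrite mule_ge0.
Qed.

(** * Operators given by a diagonal series *)

Section Diagonal.
Variables (R : realType) (H : hilbertType R).
Implicit Types (k : nat -> R) (phi : nat -> H) (x y L : H).

Definition diag_sum k phi x : nat -> H :=
  series (fun i => ((k i)%:C * hdot x (phi i)) *: phi i).

Lemma cvg_sqmod_hdot (u : nat -> H) L y : u @ \oo --> L ->
  sqmod (hdot L y - hdot (u n) y) @[n --> \oo] --> (0 : R).
Proof.
move=> /cvg_normsqP uL.
apply: (@squeeze_cvgr _ _ _ _ (fun=> 0) (fun n => normsq (L - u n) * normsq y)).
- by apply: nearW => n; rewrite sqmod_ge0 -hdotBl CauchySchwarz_sqmod.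
- exact: cvg_cst.
- by rewrite -[0 : R](mul0r (normsq y)); apply: cvgM => //; exact: cvg_cst.
Qed.

(** All terms but the i-th vanish by orthogonality, so the partial sums are constant from index
    [i.+1] on. A null [phi i] makes both sides 0. *)
Lemma diag_sum_self k phi L i : orthosystem setT phi ->
  diag_sum k phi (phi i) @ \oo --> L -> L = (k i)%:C *: phi i.
Proof.
move=> phiT /cvg_normsqP uL; apply/subr0_eq/eqP.
rewrite -normsq_eq0 eq_le normsq_ge0 andbT.
apply: cvg0_ge uL; exists i.+1 => // n /= ni.
rewrite (_ : diag_sum k phi (phi i) n = (k i)%:C *: phi i)//.
rewrite /diag_sum /series /= (bigD1_seq i) ?iota_uniq ?mem_index_iota//=.
rewrite big1 ?addr0 => [|j ji].
  by case: (proj2 phiT i I) => ->; rewrite ?mulr1// hdot0r scaler0 scaler0.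
by rewrite (proj1 phiT) ?mulr0 ?scale0r// eq_sym.
Qed.

Lemma hdot_diag_sum k phi x L i : orthosystem setT phi ->
  diag_sum k phi x @ \oo --> L -> hdot L (phi i) = (k i)%:C * hdot x (phi i).
Proof.
move=> phiT /(cvg_sqmod_hdot (phi i)) uL; apply/subr0_eq/eqP.
rewrite -sqmod_eq0 eq_le sqmod_ge0 andbT.
apply: cvg0_ge uL; exists i.+1 => // n /= ni.
rewrite /diag_sum /series /= (hdot_sum_orthosystem phiT) ?iota_uniq//.
  by rewrite -mulrA (hdot_orthosystem phiT).
by rewrite mem_index_iota.
Qed.

(** Pairing the n-th partial sum with [x] gives the real number $\sum_{i<n} k_i |\langle x,
    \varphi_i\rangle|^2$; its squared distance to the real part of the limit is at most the squared
    modulus handled by [cvg_sqmod_hdot]. *)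
Lemma Re_hdot_diag_sum k phi x L :
  (forall i, 0 <= k i) -> diag_sum k phi x @ \oo --> L ->
  (complex.Re (hdot L x))%:E = (\esum_(i in setT) (k i * coef phi x i)%:E)%E.
Proof.
move=> k0 /(cvg_sqmod_hdot x) uL; rewrite -nneseries_esumT; last first.
  by move=> i; rewrite lee_fin mulr_ge0 ?coef_ge0.
apply/esym/cvg_lim => //.
rewrite (_ : (fun n => _) = EFin \o series (fun i => k i * coef phi x i)); last first.
  by apply/funext => n /=; rewrite sumEFin.
apply: cvg_EFin; first exact: nearW.
rewrite (_ : fine \o _ = series (fun i => k i * coef phi x i)); last exact/funext.
apply/cvgrPdist_lt => e e0.
move/cvgrPdist_lt : uL => /(_ (e ^+ 2)); rewrite exprn_gt0// => /(_ isT).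
apply: filterS => n; rewrite sub0r normrN ger0_norm ?sqmod_ge0//.
rewrite /diag_sum /series /= hdot_suml.
rewrite (_ : \sum_(i <- _) _ = (\sum_(0 <= i < n) k i * coef phi x i)%:C); last first.
  rewrite rmorph_sum; apply: eq_bigr => i _.
  by rewrite -mulrA (hdot_conj (phi i)) mul_conj_sqmod -rmorphM.
set a := \sum_(0 <= i < n) _; case: (hdot L x) => b c; rewrite /sqmod /= => h.
rewrite -(ltr_pXn2r (ltn0Sn 1)) ?nnegrE ?normr_ge0 ?ltW// real_normK ?num_real//.
by apply: le_lt_trans h; rewrite lerDl sqr_ge0.
Qed.

End Diagonal.

(** * Trace of diagonal operators *)

Section Trace.
Variables (R : realType) (H : hilbertType R).
Implicit Types (A : H -> H) (l : nat -> R) (phi : nat -> H).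

Let basis : set H := xget set0 (@orthonormal_basis R H).

Lemma spectral_orthosystem A l phi :
  spectral_decomposition A l phi -> orthosystem setT phi.
Proof.
case=> _ orth norm1 _; split=> [i j _ _|i _]; first exact: orth.
by have [|[]] := norm1 i; [left|right].
Qed.

Lemma spectral_diag_sum A l phi x :
  spectral_decomposition A l phi -> diag_sum l phi x @ \oo --> A x.
Proof. by case=> _ _ _ /(_ x). Qed.

Lemma basis_orthosystem : orthosystem basis id.
Proof.
have [[B BP]|nex] := pselect (exists B, @orthonormal_basis R H B).
  have [orth _] : orthonormal_basis basis by apply: (@xgetPex _ set0); exists B.
  split=> [e e' Be Be' ee'|e Be]; first by rewrite orth// (negbTE ee').
  by left; rewrite orth// eqxx.
(* Without any orthonormal basis, [xget] returns its default [set0], over which the claim is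
   vacuous. *)
rewrite /basis (_ : xget _ _ = set0) //.
by apply: xgetPN => B BP; apply: nex; exists B.
Qed.

(* A state has nonzero trace, so the basis in the definition of the trace cannot
   be the default value set0. *)
Lemma state_basis A : state A -> orthonormal_basis basis.
Proof.
case=> _ trA; have [exB|nex] := pselect (exists B, @orthonormal_basis R H B).
  exact: (@xgetPex _ set0).
move: trA; rewrite /trace (_ : xget _ _ = set0); last first.
  by apply: xgetPN => B BP; apply: nex; exists B.
by rewrite esum_set0 => -[] /esym/eqP; rewrite oner_eq0.
Qed.

(** Tonelli for the nonnegative double family $k_i |\langle e, \varphi_i\rangle|^2$, without
    assuming the index set [basis] to be complete. *)
Lemma trace_diag_sum A (k : nat -> R) phi :
  (forall i, 0 <= k i) -> (forall x, diag_sum k phi x @ \oo --> A x) ->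
  (trace A = \esum_(i in setT) ((k i)%:E *
    \esum_(e in basis) (coef id (phi i) e)%:E))%E.
Proof.
move=> k0 kA; rewrite /trace -/basis.
rewrite [LHS](_ : _ = \esum_(e in basis) \esum_(i in setT)
    (k i * coef phi e i)%:E)%E; last first.
  by apply: eq_esum => e _; exact: Re_hdot_diag_sum (kA e).
rewrite esum_exchange => [|e i]; last by rewrite lee_fin mulr_ge0 ?coef_ge0.
apply: eq_esum => i _; rewrite -esumZl// => [|e]; last by rewrite lee_fin coef_ge0.
by apply: eq_esum => e _; rewrite -EFinM /coef sqmod_hdotC.
Qed.

Lemma trace_spectral A l phi :
  orthonormal_basis basis -> spectral_decomposition A l phi ->
  (trace A = \esum_(i in setT) (l i)%:E)%E.
Proof.
move=> [_ complB] sd; have [l0 _ norm1 cvgA] := sd.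
rewrite (trace_diag_sum l0 cvgA); apply: eq_esum => i _.
rewrite (Parseval basis_orthosystem)// -EFinM.
by have [phi1|[-> ->]] := norm1 i; rewrite ?mul0r// /normsq phi1 mulr1.
Qed.

End Trace.

(** * The function $-x \log x$ *)

Section Eta.
Variable R : realType.
Implicit Types x q : R.

Lemma eta0 : eta (0 : R) = 0.
Proof. by rewrite /eta mul0r oppr0. Qed.

(* Termwise Gibbs inequality. *)
Lemma eta_le x q : 0 <= x -> 0 < q -> eta x <= q - x - x * ln q.
Proof.
move=> x0 q0; have [->|xn0] := eqVneq x 0.
  by rewrite eta0 mul0r !subr0 ltW.
have xp : 0 < x by rewrite lt_neqAle eq_sym xn0.
have := @le_ln1Dx R (q / x - 1); rewrite addrCA subrr addr0.
rewrite ltrBrDl addrN divr_gt0// => /(_ isT).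
move=> h; have : x * (ln q - ln x) <= x * (q / x - 1).
  by rewrite ler_pM2l// -ln_div.
by rewrite !mulrBr mulrCA divff// !mulr1 /eta; lra.
Qed.

Lemma eta_ge0 x : 0 <= x <= 1 -> 0 <= eta x.
Proof. by move=> /andP[x0 x1]; rewrite /eta -mulrN mulr_ge0// oppr_ge0 ln_le0. Qed.

Lemma eta_le1 x : 0 <= x -> eta x <= 1.
Proof.
by move=> x0; have := eta_le x0 ltr01; rewrite ln1 mulr0 subr0; lra.
Qed.

(** With $t = \sqrt{x}$ one has $\eta(x) = 2 t\, \eta(t)$ and $\eta(t) \le 1 - t \le 1$. This gives
    the limit of [eta] at 0, where [ln] is not continuous. *)
Lemma eta_le_sqrt x : 0 <= x -> eta x <= 2 * Num.sqrt x.
Proof.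
move=> x0; have [->|xn0] := eqVneq x 0.
  by rewrite eta0 sqrtr0 mulr0.
have xp : 0 < x by rewrite lt_neqAle eq_sym xn0.
have sp : 0 < Num.sqrt x by rewrite sqrtr_gt0.
have aux (t u : R) : 0 < t -> - (t * u) <= 1 - t -> - (t * t * (u + u)) <= 2 * t.
  move=> t0 tu; have : 0 <= t * (1 - t + t * u) by rewrite (mulr_ge0 (ltW t0))//; lra.
  have : 0 <= t * t by rewrite mulr_ge0 ?ltW.
  lra.
have := eta_le (sqrtr_ge0 x) ltr01; rewrite ln1 mulr0 subr0 /eta => h.
by rewrite -{1 2}(sqr_sqrtr x0) expr2 lnM ?posrE//; exact: aux.
Qed.

Lemma cvg_eta_at0 (u : nat -> R) :
  (forall n, 0 <= u n <= 1) -> u @ \oo --> (0 : R) -> eta (u n) @[n --> \oo] --> (0 : R).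
Proof.
move=> u01 u0.
apply: (@squeeze_cvgr _ _ _ _ (fun=> 0) (fun n => 2 * Num.sqrt (u n))).
- by apply: nearW => n; rewrite eta_ge0// eta_le_sqrt//; have /andP[] := u01 n.
- exact: cvg_cst.
- rewrite -[0 : R](mulr0 2) -(@sqrtr0 R); apply: cvgM; first exact: cvg_cst.
  by apply: continuous_cvg => //; exact: sqrt_continuous.
Qed.

Lemma cvg_eta_at1 (u : nat -> R) :
  u @ \oo --> (1 : R) -> eta (u n) @[n --> \oo] --> (0 : R).
Proof.
move=> u1; rewrite -[0 : R]oppr0 -(mulr0 1) -(@ln1 R).
apply: cvgN; apply: cvgM => //; apply: continuous_cvg => //.
exact: continuous_ln.
Qed.

End Eta.

(** * Entropy bound from an arbitrary spectral decomposition *)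

Section Entropy.
Variables (R : realType) (H : hilbertType R).
Implicit Types (A : H -> H) (l : nat -> R) (phi : nat -> H).

(* The entropy is defined from a decomposition (mu, psi) chosen by xget, which need
   not be the given one (l, phi).  The overlaps |<psi_i|phi_j>|^2 intertwine the
   two: they vanish unless mu_i = l_j, and sum to 1 over j when mu_i <> 0. *)
Lemma spectral_overlap A l phi mu psi i j :
  spectral_decomposition A l phi -> spectral_decomposition A mu psi ->
  mu i * coef phi (psi i) j = l j * coef phi (psi i) j.
Proof.
move=> sdl sdm.
have Apsi := diag_sum_self (spectral_orthosystem sdm) (spectral_diag_sum (x := psi i) sdm).
have := hdot_diag_sum j (spectral_orthosystem sdl) (spectral_diag_sum (x := psi i) sdl).
rewrite Apsi hdotZl => /eqP; rewrite -subr_eq0 -mulrBl mulf_eq0 => /orP[].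
  by rewrite subr_eq0 => /eqP/complexI ->.
by rewrite /coef => /eqP ->; rewrite sqmod0 !mulr0.
Qed.

(** Evaluating $\langle A\psi_i, \psi_i\rangle$ in both decompositions gives $\mu_i = \sum_j l_j
    |\langle\psi_i, \varphi_j\rangle|^2$. The right-hand side is $\mu_i$ times the total overlap,
    and $\mu_i \ne 0$ cancels. *)
Lemma spectral_mass A l phi mu psi i :
  spectral_decomposition A l phi -> spectral_decomposition A mu psi ->
  mu i != 0 -> (\esum_(j in setT) (coef phi (psi i) j)%:E = 1)%E.
Proof.
move=> sdl sdm mui0.
have Apsi := diag_sum_self (spectral_orthosystem sdm) (spectral_diag_sum (x := psi i) sdm).
have [l0 _ _ _] := sdl; have [m0 _ norm1 _] := sdm.
have := Re_hdot_diag_sum l0 (spectral_diag_sum (x := psi i) sdl).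
rewrite Apsi hdotZl; have [->|[_ /eqP]] := norm1 i; last by rewrite (negbTE mui0).
have mup : 0 < mu i by rewrite lt_neqAle eq_sym mui0 m0.
rewrite mulr1 /=.
rewrite (_ : esum _ _ =
    \esum_(j in setT) ((mu i)%:E * (coef phi (psi i) j)%:E))%E; last first.
  by apply: eq_esum => j _; rewrite -EFinM (spectral_overlap _ _ sdl sdm).
rewrite esumZl//; last by move=> j; rewrite lee_fin coef_ge0.
case: (esum _ _) => [r| |].
- rewrite -EFinM => -[] /eqP; rewrite -{1}[mu i]mulr1 -subr_eq0 -mulrBr mulf_eq0.
  by rewrite (negbTE mui0)/= subr_eq0 => /eqP <-.
- by rewrite gt0_muley ?lte_fin.
- by rewrite gt0_muleNy ?lte_fin.
Qed.

(** If $\mu_i$ differed from every $l_j$, all overlaps would vanish, against their total mass 1. *)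
Lemma spectral_range A l phi mu psi i :
  spectral_decomposition A l phi -> spectral_decomposition A mu psi ->
  mu i != 0 -> exists j, mu i = l j.
Proof.
move=> sdl sdm mui0; apply: contrapT => nex.
have := spectral_mass sdl sdm mui0; rewrite esum1.
  by move=> [] /esym/eqP; rewrite oner_eq0.
move=> j _; have /eqP := spectral_overlap i j sdl sdm.
rewrite -subr_eq0 -mulrBl mulf_eq0 subr_eq0 => /orP[/eqP mil|/eqP ->//].
by exfalso; apply: nex; exists j.
Qed.

Lemma functional_calculusP (g : R -> R) A l phi :
  spectral_decomposition A l phi ->
  exists (mu : nat -> R) (psi : nat -> H), spectral_decomposition A mu psi /\
    functional_calculus g A = fun x => limn (diag_sum (fun i => g (mu i)) psi x).
Proof.
move=> sdl; rewrite /functional_calculus.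
have /(xgetPex (fun=> 0, fun=> 0)) :
    exists d, [set d | spectral_decomposition A d.1 d.2] d by exists (l, phi).
by case: (xget _ _) => mu psi /= sdm; exists mu, psi.
Qed.

(** Overlaps allow $\eta(\mu_i)$ to be replaced by $\eta(l_j)$ inside the sum over $j$. After
    exchanging the sums, the overlaps of a fixed $\varphi_j$ with all $\psi_i$ add up to at most 1
    by Bessel. *)
Lemma entropy_le A l phi :
  spectral_decomposition A l phi -> (forall i, l i <= 1) ->
  (entropy A <= \esum_(i in setT) (eta (l i))%:E)%E.
Proof.
move=> sdl l1; rewrite /entropy.
have [mu [psi [sdm ->]]] := functional_calculusP (@eta R) sdl.
have l0 : forall i, 0 <= l i by case: sdl.
have mu01 i : 0 <= mu i <= 1.
  have [->|mui0] := eqVneq (mu i) 0; first by rewrite lexx ler01.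
  by have [j ->] := spectral_range sdl sdm mui0; rewrite l0 l1.
have eta_mu0 i : 0 <= eta (mu i) by exact: eta_ge0.
have eta_l0 i : 0 <= eta (l i) by rewrite eta_ge0// l0 l1.
have phiT := spectral_orthosystem sdl; have psiT := spectral_orthosystem sdm.
have basisP := @basis_orthosystem R H.
(* The weights [eta (mu i)] lie in the unit interval, so the series converges and the [limn] of the
   functional calculus is a true limit. *)
rewrite (trace_diag_sum (k := fun i => eta (mu i)) (phi := psi))//; last first.
  move=> x; apply: is_cvg_orthogonal_series => // i /=.
  by rewrite eta_mu0 eta_le1//; have /andP[] := mu01 i.
apply: (@le_trans _ _ (\esum_(i in setT) \esum_(j in setT)
    ((eta (l j))%:E * (coef phi (psi i) j)%:E))%E).
  apply: le_esum => i _ /=.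
  rewrite (_ : esum setT _ = \esum_(j in setT)
      ((eta (mu i))%:E * (coef phi (psi i) j)%:E))%E; last first.
    apply: eq_esum => j _; have /eqP := spectral_overlap i j sdl sdm.
    rewrite -subr_eq0 -mulrBl mulf_eq0 subr_eq0 => /orP[/eqP ->//|/eqP ->].
    by rewrite !mule0.
  rewrite esumZl//; last by move=> j; rewrite lee_fin coef_ge0.
  have [->|mui0] := eqVneq (mu i) 0; first by rewrite eta0 !mul0e.
  rewrite (spectral_mass sdl sdm)// lee_wpmul2l ?lee_fin//.
  apply: le_trans (Bessel basisP _) _; rewrite lee_fin.
  exact: normsq_orthosystem_le1 psiT _ _.
rewrite esum_exchange => [|i j]; last by rewrite mule_ge0// lee_fin ?coef_ge0.
apply: le_esum => j _; rewrite esumZl//; last by move=> i; rewrite lee_fin coef_ge0.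
rewrite -[leRHS]mule1 lee_wpmul2l ?lee_fin//.
rewrite (_ : esum _ _ = \esum_(i in setT) (coef psi (phi j) i)%:E)%E; last first.
  by apply: eq_esum => i _; rewrite /coef sqmod_hdotC.
apply: le_trans (Bessel psiT _) _; rewrite lee_fin.
exact: normsq_orthosystem_le1 phiT _ _.
Qed.

End Entropy.

(** * Series of nonnegative reals, their heads and tails *)

Section RealSeries.
Variable R : realType.
Implicit Types (f g : nat -> R) (s : R).

Lemma esum_cvg_series f s : (forall i, 0 <= f i) -> series f @ \oo --> s ->
  (\esum_(i in setT) (f i)%:E = s%:E)%E.
Proof.
move=> f0 fs; rewrite -nneseries_esumT; last by move=> i; rewrite lee_fin.
apply: cvg_lim => //.
rewrite (_ : (fun n => _) = EFin \o series f); last first.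
  by apply/funext => n /=; rewrite sumEFin.
by apply: cvg_EFin => //; exact: nearW.
Qed.

Lemma cvg_series_esum f : (forall i, 0 <= f i) ->
  (\esum_(i in setT) (f i)%:E < +oo)%E -> cvgn (series f).
Proof.
move=> f0; rewrite -nneseries_esumT; last by move=> i; rewrite lee_fin.
move=> foo; apply: nondecreasing_is_cvgn.
  apply/nondecreasing_seqP => n.
  by rewrite /series /= big_nat_recr//= lerDl.
exists (fine (\sum_(i <oo) (f i)%:E)%E) => _ [n _ <-].
rewrite -lee_fin fineK; last first.
  by rewrite ge0_fin_numE// nneseries_ge0// => i _; rewrite lee_fin.
rewrite /series /= -sumEFin; apply: nneseries_lim_ge => i _ _.
by rewrite lee_fin.
Qed.

Lemma series_head (V : zmodType) (f : nat -> V) n r : (r <= n)%N ->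
  series (fun i => if (i < r)%N then f i else 0) n = series f r.
Proof.
move=> rn; rewrite /series /= (@big_cat_nat _ _ _ r 0 n)//=.
rewrite [X in _ + X]big_nat_cond [X in _ + X]big1 ?addr0; last first.
  by move=> i /andP[/andP[ri _] _]; rewrite ltnNge ri.
by rewrite !big_nat; apply: eq_bigr => i /andP[_ ->].
Qed.

Lemma series_tail (V : zmodType) (f : nat -> V) n r : (r <= n)%N ->
  series (fun i => if (i < r)%N then 0 else f i) n = series f n - series f r.
Proof.
move=> rn; apply/esym/eqP; rewrite subr_eq -(series_head f rn) /series /= -big_split/=.
by apply/eqP/eq_bigr => i _; case: ifP; rewrite ?add0r ?addr0.
Qed.

Lemma cvg_series_head f r a :
  series (fun i => a * if (i < r)%N then f i else 0) @ \oo --> a * series f r.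
Proof.
apply: cvg_near_cst; exists r => // n /= rn.
by rewrite -(series_head f rn) /series /= big_distrr.
Qed.

Lemma cvg_series_tail f r a s : series f @ \oo --> s ->
  series (fun i => a * if (i < r)%N then 0 else f i) @ \oo -->
  a * (s - series f r).
Proof.
move=> fs; apply: (@cvg_trans _ (a * (series f n - series f r) @[n --> \oo])).
  apply: near_eq_cvg; exists r => // n /= rn.
  by rewrite -(series_tail f rn) /series /= big_distrr.
by apply: cvgM; [exact: cvg_cst|apply: cvgB => //; exact: cvg_cst].
Qed.

Lemma esum_ge_term f s i : (forall i, 0 <= f i) ->
  (\esum_(i in setT) (f i)%:E = s%:E)%E -> f i <= s.
Proof.
move=> f0 fs; rewrite -lee_fin -fs; apply: esum_ge.
by exists [set i]; [split => //; exact: finite_set1|rewrite fsbig_set1].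
Qed.

(** Indeed $\eta(x/c) = (\eta(x) + x \log c)/c$ and $\log c \le 0$. *)
Lemma eta_scale (c x : R) : 0 < c <= 1 -> 0 <= x -> eta (c^-1 * x) <= c^-1 * eta x.
Proof.
move=> /andP[c0 c1] x0; have [->|xn0] := eqVneq x 0.
  by rewrite mulr0 eta0 mulr0.
have xp : 0 < x by rewrite lt_neqAle eq_sym xn0.
rewrite /eta lnM ?posrE ?invr_gt0// lnV ?posrE// mulrN lerN2 -!mulrA.
rewrite ler_pM2l ?invr_gt0// ler_pM2l// lerDr oppr_ge0.
exact: ln_le0.
Qed.

End RealSeries.

(** * From a spectral decomposition of mass 1 to a state *)

Section SpectralState.
Variables (R : realType) (H : hilbertType R).
Implicit Types (A : H -> H) (l : nat -> R) (phi : nat -> H).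

Lemma diag_sumP k phi (x y : H) a n :
  diag_sum k phi (a *: x + y) n = a *: diag_sum k phi x n + diag_sum k phi y n.
Proof.
rewrite /diag_sum /series /= scaler_sumr -big_split /=; apply: eq_bigr => i _.
by rewrite hdotDl hdotZl mulrDr scalerDl scalerA mulrCA.
Qed.

Lemma spectral_linear A l phi : spectral_decomposition A l phi -> linear A.
Proof.
move=> sd a x y; have cvgA z := spectral_diag_sum (x := z) sd.
apply: (cvg_unique (@norm_hausdorff _ _) (cvgA _)).
rewrite (_ : diag_sum l phi (a *: x + y) =
  (fun n => a *: diag_sum l phi x n + diag_sum l phi y n)); last first.
  by apply/funext => n; rewrite diag_sumP.
by apply: cvgD => //; apply: cvgZr.
Qed.

Lemma spectral_hdot_ge0 A l phi x :
  spectral_decomposition A l phi -> 0 <= hdot (A x) x.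
Proof.
move=> sd; have cvgA := spectral_diag_sum (x := x) sd.
have [l0 _ _ _] := sd; rewrite lecE /=; apply/andP; split; last first.
  rewrite -lee_fin (Re_hdot_diag_sum l0 cvgA) esum_ge0// => i _.
  by rewrite lee_fin mulr_ge0 ?coef_ge0.
(* The order of [R[i]] also demands a zero imaginary part. The partial sums pair with [x] to real
   numbers, so its square is below a null sequence. *)
rewrite -(sqrf_eq0 (complex.Im _)) eq_le sqr_ge0 andbT.
apply: cvg0_ge (cvg_sqmod_hdot x cvgA); apply: nearW => n.
rewrite /diag_sum /series /= hdot_suml.
rewrite (_ : \sum_(i <- _) _ = (\sum_(0 <= i < n) l i * coef phi x i)%:C); last first.
  rewrite rmorph_sum; apply: eq_bigr => i _.
  by rewrite -mulrA (hdot_conj (phi i)) mul_conj_sqmod -rmorphM.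
by case: (hdot (A x) x) => b c; rewrite /sqmod /= oppr0 addr0 lerDr sqr_ge0.
Qed.

(** The factor 2 comes from [normsqD_le], applied to [A x] split at a partial sum [u] with
    [normsq u <= normsq x]; it is harmless for continuity. *)
Lemma spectral_normsq_le A l phi x : spectral_decomposition A l phi ->
  (forall i, l i <= 1) -> normsq (A x) <= normsq x *+ 2.
Proof.
move=> sd l1; have [l0 _ _ cvgA] := sd.
rewrite -subr_le0; apply: (@cvg0_ge _
  (fun n => normsq (A x - diag_sum l phi x n) *+ 2)); last first.
  by rewrite -[0 : R](mul0rn _ 2); apply: cvgMn; apply/cvg_normsqP; exact: cvgA.
apply: nearW => n; set u := diag_sum _ _ _ _.
have un : normsq u <= normsq x.
  rewrite /u /diag_sum /series /=.
  rewrite (normsq_expansion_weighted (spectral_orthosystem sd)) ?iota_uniq//.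
  apply: le_trans (Bessel_seq (spectral_orthosystem sd) (iota_uniq 0 (n - 0)) _ x) => //.
  by apply: ler_sum => i _; rewrite ler_piMl ?coef_ge0// expr_le1.
have := normsqD_le (A x - u) u; rewrite subrK => h.
by rewrite lerBlDr; apply: le_trans h _; rewrite lerD2l lerMn2r un.
Qed.

Lemma spectral_continuous A l phi : spectral_decomposition A l phi ->
  (forall i, l i <= 1) -> continuous A.
Proof.
move=> sd l1 x; have linA := spectral_linear sd.
apply/cvgrPdist_lt => -[e e']; rewrite ltcE /= => /andP[/eqP-> e0].
have e20 : 0 < e / 2 by rewrite divr_gt0.
apply/nbhs_ballP; exists (e / 2)%:C => /=; first by rewrite ltcR.
move=> y; rewrite -ball_normE /= !normr_lt_normsq// => xy.
have -> : A x - A y = A (x - y).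
  by rewrite -scaleN1r -[- y]scaleN1r [in RHS]addrC linA addrC.
apply: le_lt_trans (spectral_normsq_le _ sd l1) _.
have := normsq_ge0 (x - y); rewrite mulr2n; move: xy; rewrite !expr2; lra.
Qed.

Lemma spectral_state A l phi :
  orthonormal_basis (xget set0 (@orthonormal_basis R H)) ->
  spectral_decomposition A l phi ->
  (\esum_(i in setT) (l i)%:E = 1)%E -> state A.
Proof.
move=> basisP sd l1; split; last by rewrite (trace_spectral basisP sd).
split; first exact: spectral_linear sd.
- apply: (spectral_continuous sd) => i; apply: esum_ge_term l1.
  by case: sd.
- by move=> x; exact: spectral_hdot_ge0 sd.
Qed.

End SpectralState.

(** * The truncated operator and the normalized tail *)

Section Truncation.
Variables (R : realType) (H : hilbertType R).
Implicit Types (A : H -> H) (l : nat -> R) (phi : nat -> H).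

Lemma projector_comp A l phi r : spectral_decomposition A l phi ->
  projector phi r \o A = fun x => diag_sum l phi x r.
Proof.
move=> sd; apply/funext => x /=.
rewrite /projector /diag_sum /series /= big_mkord; apply: eq_bigr => i _.
by rewrite (hdot_diag_sum _ (spectral_orthosystem sd) (spectral_diag_sum sd)).
Qed.

(** Common form of head and tail. Masked weights become zeros in place, so the same [phi] serves;
    the resulting sequence need not be monotone, which [spectral_decomposition] permits. *)
Lemma spectral_mask A B l phi (a : R) (h : nat -> bool) :
  spectral_decomposition A l phi -> 0 <= a ->
  (forall x, series (fun i => if h i
      then ((l i)%:C * hdot x (phi i)) *: phi i else 0) @ \oo --> B x) ->
  spectral_decomposition (a%:C *: B) (fun i => a * if h i then l i else 0) phi.
Proof.
move=> [l0 orth norm1 _] a0 cvgB; split => //.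
- by move=> i; rewrite mulr_ge0//; case: ifP.
- move=> i; have [|[-> li0]] := norm1 i; first by left.
  by right; split => //; case: ifP; rewrite ?li0 mulr0.
- move=> x.
  rewrite (_ : series _ = (fun n => a%:C *: series (fun i => if h i
      then ((l i)%:C * hdot x (phi i)) *: phi i else 0) n)); last first.
    apply/funext => n; rewrite /series /= scaler_sumr; apply: eq_bigr => i _.
    case: ifP => _; last by rewrite mulr0 mul0r scale0r scaler0.
    by rewrite scalerA mulrA rmorphM.
  exact: cvgZr.
Qed.

Lemma spectral_head A l phi r (a : R) :
  spectral_decomposition A l phi -> 0 <= a ->
  spectral_decomposition (a%:C *: (projector phi r \o A))
    (fun i => a * if (i < r)%N then l i else 0) phi.
Proof.
move=> sd a0; apply: (spectral_mask (h := fun i => (i < r)%N) sd a0) => x.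
rewrite (projector_comp _ sd); apply: cvg_near_cst; exists r => // n /= rn.
by rewrite series_head.
Qed.

Lemma spectral_tail A l phi r (a : R) :
  spectral_decomposition A l phi -> 0 <= a ->
  spectral_decomposition (a%:C *: (A - (projector phi r \o A)))
    (fun i => a * if (i < r)%N then 0 else l i) phi.
Proof.
move=> sd a0.
rewrite (_ : (fun i => _) = (fun i => a * if ~~ (i < r)%N then l i else 0)); last first.
  by apply/funext => i; case: ifP.
apply: (spectral_mask (h := fun i => ~~ (i < r)%N) sd a0) => x.
rewrite (projector_comp _ sd).
apply: (@cvg_trans _ ((diag_sum l phi x n - diag_sum l phi x r) @[n --> \oo])).
  apply: near_eq_cvg; exists r => // n /= rn.
  rewrite /diag_sum -(series_tail _ rn) /series /=.
  by apply: eq_bigr => i _; case: ifP.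
by apply: cvgB; [exact: spectral_diag_sum sd|exact: cvg_cst].
Qed.

Lemma state_mass A l phi : state A -> spectral_decomposition A l phi ->
  (\esum_(i in setT) (l i)%:E = 1)%E.
Proof.
by move=> stA sd; have [_ <-] := stA; rewrite (trace_spectral (state_basis stA) sd).
Qed.

Lemma spectral_weight_le1 A l phi i :
  state A -> spectral_decomposition A l phi -> l i <= 1.
Proof.
move=> stA sd; apply: esum_ge_term (state_mass stA sd).
by case: sd.
Qed.

Lemma spectral_mass_cvg A l phi : state A -> spectral_decomposition A l phi ->
  series l @ \oo --> (1 : R).
Proof.
move=> stA sd; have l0 : forall i, 0 <= l i by case: sd.
have mass := state_mass stA sd.
have sl : cvgn (series l) by apply: cvg_series_esum => //; rewrite mass ltry.
by have := esum_cvg_series l0 sl; rewrite mass => -[->].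
Qed.

Lemma truncationE A l phi r : state A -> spectral_decomposition A l phi ->
  truncation A phi r = ((series l r)^-1)%:C *: (projector phi r \o A).
Proof.
move=> stA sd; have l0 : forall i, 0 <= l i by case: sd.
(* The factor 1 gives the unnormalized operator, whose trace is the sum of the first [r] weights. *)
have := spectral_head r sd ler01; rewrite (_ : 1%:C = 1) // scale1r => sdh.
rewrite /truncation (trace_spectral (state_basis stA) sdh).
rewrite (esum_cvg_series _ (@cvg_series_head _ l r 1)) /= ?mul1r// => i.
by rewrite mul1r; case: ifP.
Qed.

Lemma mixtureE (c : R) A B : 0 < c < 1 ->
  A = mixture c (c^-1%:C *: B) ((1 - c)^-1%:C *: (A - B)).
Proof.
move=> /andP[c0 c1]; rewrite /mixture !scalerA -!rmorphM /= !divff ?gt_eqF//.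
  by rewrite !scale1r addrC subrK.
by rewrite subr_gt0.
Qed.

End Truncation.

(** * Finiteness of the entropy series and the vanishing bound *)

Section Bound.
Variable R : realType.
Implicit Types l : nat -> R.

(** Once $\sum_i e^{-\beta g_i}$ is finite for some $\beta > 0$, [eta_le] with $q = e^{-\beta g_i}$
    gives $\eta(l_i) \le \beta l_i g_i + e^{-\beta g_i}$, and both families are summable. *)
Lemma FA_entropy_cvg l (g : nat -> R) :
  (forall i, 0 <= l i <= 1) -> (forall i, 0 <= g i) ->
  (\sum_(0 <= i <oo) (l i * g i)%:E < +oo)%E ->
  (fun beta : R =>
     poweR (\sum_(0 <= i <oo) (expR (- (beta * g i)))%:E)%E beta)
    @ 0^'+ --> 1%E ->
  cvgn (series (fun i => eta (l i))).
Proof.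
move=> l01 g0 lg FA.
have l0 i : 0 <= l i by have /andP[] := l01 i.
have [beta beta0 expfin] : exists2 beta : R, 0 < beta &
    (\sum_(0 <= i <oo) (expR (- (beta * g i)))%:E < +oo)%E.
  have : \forall beta \near 0^'+, 0 < beta /\
      (poweR (\sum_(0 <= i <oo) (expR (- (beta * g i)))%:E)%E beta < +oo)%E.
    near=> beta; split; first by near: beta; exact: nbhs_right_gt.
    near: beta; have /FA : nbhs (1%E : \bar R) [set x | (x < +oo)%E].
      by apply: open_nbhs_nbhs; split; [exact: open_ereal_lt_ereal|exact: ltry].
    by apply.
  move=> /filter_ex[beta [b0 fin]]; exists beta => //.
  (* An infinite sum would have an infinite power, since [beta] is positive, against the limit 1. *)
  rewrite ltey; apply: contraTneq fin => ->.
  by rewrite poweRyr ?gt_eqF.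
apply: cvg_series_esum => [i|]; first exact: eta_ge0.
apply: (@le_lt_trans _ _ (\esum_(i in setT)
    (beta%:E * (l i * g i)%:E + (expR (- (beta * g i)))%:E))%E).
  apply: le_esum => i _; rewrite -EFinM -EFinD lee_fin.
  have := eta_le (l0 i) (expR_gt0 (- (beta * g i))); rewrite expRK.
  have := l0 i; set e := expR _; rewrite mulrN opprK mulrCA.
  lra.
rewrite esumD; first last.
- by move=> i _; rewrite lee_fin expR_ge0.
- by move=> i _; rewrite mule_ge0 ?lee_fin ?mulr_ge0// ltW.
rewrite esumZl ?ltW//; last by move=> i; rewrite lee_fin mulr_ge0.
rewrite -!nneseries_esumT; first last.
- by move=> i; rewrite lee_fin mulr_ge0.
- by move=> i; rewrite lee_fin expR_ge0.
rewrite lte_add_pinfty// lte_mul_pinfty// ?lee_fin; first exact: ltW.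
Unshelve. all: by end_near. Qed.

(** Built from the weight sequence and the three constants alone, so that a single function serves
    all spaces and states with the same spectrum. *)
Definition truncation_bound l (C T D : R) (r : nat) : R :=
  let c := series l r in
  let s := series (fun i => eta (l i)) in
  D * binary_entropy c + 2 * T * (1 - c) +
    C * ((1 - c) * (limn s / c) + (limn s - s r)).

Lemma cvg_truncation_bound l C T D :
  (forall i, 0 <= l i) -> series l @ \oo --> (1 : R) ->
  cvgn (series (fun i => eta (l i))) ->
  truncation_bound l C T D r @[r --> \oo] --> (0 : R).
Proof.
move=> l0 l1 s_cvg; rewrite /truncation_bound.
have c1 r : series l r <= 1.
  rewrite -(cvg_lim _ l1)//; apply: nondecreasing_cvgn_le.
    by apply/nondecreasing_seqP => n; rewrite /series /= big_nat_recr//= lerDl.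
  by apply/cvg_ex; exists 1.
have c0 r : 0 <= series l r by rewrite /series /= sumr_ge0.
have cvg1c : 1 - series l r @[r --> \oo] --> (0 : R).
  by rewrite -(subrr (1 : R)); apply: cvgB => //; exact: cvg_cst.
set S := limn _.
(* The limit 0 is written as the value of the bound at [c = 1] and [s = S], to pass to the limit
   term by term. *)
rewrite (_ : (0 : R) = D * (0 + 0) + 2 * T * 0 + C * (0 * (S / 1) + (S - S))); last first.
  by rewrite subrr mul0r !addr0 !mulr0 !addr0.
apply: cvgD; first (apply: cvgD).
- apply: cvgM; first exact: cvg_cst.
  apply: cvgD; first exact: cvg_eta_at1.
  apply: cvg_eta_at0 => // n.
  by rewrite subr_ge0 c1 lerBlDr lerDl c0.
- by apply: cvgM => //; exact: cvg_cst.
- apply: cvgM; first exact: cvg_cst.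
  apply: cvgD; last by apply: cvgB => //; exact: cvg_cst.
  apply: cvgM => //; apply: cvgM; first exact: cvg_cst.
  by apply: cvgV => //; exact: oner_neq0.
Qed.

End Bound.

(** * Estimates for functions of the class and for the truncation *)

Section ClassL.
Variables (R : realType) (H : hilbertType R).
Implicit Types (A : H -> H) (f : (H -> H) -> R).

(** Each one-sided bound uses only one of the two constants summing to [C], and one of those summing
    to [T]; adding the other, nonnegative, ones gives a two-sided bound. *)
Lemma class_L_le f (C T D M : R) A : class_L C T D f ->
  finite_entropy_state A -> 0 <= M -> (entropy A <= M%:E)%E ->
  `|f A| <= C * M + T.
Proof.
move=> [a [b [cm [cp [tm [tp]]]]]].
move=> [[a0 b0 cm0 cp0] [tm0 tp0] [_ <- <-] _ /(_ A) bnd] finA M0 SM.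
have {}SM : fine (entropy A) <= M.
  by move: SM finA => + [_]; case: (entropy A) => [s| |]//=; rewrite lee_fin.
have /andP[lo hi] := bnd finA.
have cmS : cm * fine (entropy A) <= cm * M by rewrite ler_wpM2l.
have cpS : cp * fine (entropy A) <= cp * M by rewrite ler_wpM2l.
have : 0 <= cm * M by rewrite mulr_ge0.
have : 0 <= cp * M by rewrite mulr_ge0.
by rewrite ler_norml mulrDl => ? ?; apply/andP; split; lra.
Qed.

Lemma class_L_mixture f (C T D p : R) A B : class_L C T D f ->
  finite_entropy_state A -> finite_entropy_state B -> 0 < p < 1 ->
  `|f (mixture p A B) - p * f A - (1 - p) * f B| <= D * binary_entropy p.
Proof.
move=> [a [b [cm [cp [tm [tp]]]]]].
move=> [[a0 b0 _ _] _ [<- _ _] /(_ A B p) bnd _] finA finB p01.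
have /andP[lo hi] := bnd finA finB p01.
have h0 : 0 <= binary_entropy p.
  by rewrite /binary_entropy addr_ge0// eta_ge0//; lra.
have : 0 <= a * binary_entropy p by rewrite mulr_ge0.
have : 0 <= b * binary_entropy p by rewrite mulr_ge0.
by rewrite ler_norml mulrDl => ? ?; apply/andP; split; lra.
Qed.

Lemma truncation_le f (C T D : R) rho (l : nat -> R) (phi : nat -> H) r :
  state rho -> spectral_decomposition rho l phi ->
  cvgn (series (fun i => eta (l i))) ->
  0 <= C -> 0 <= T -> 0 <= D -> class_L C T D f -> 0 < series l r ->
  `|f (truncation rho phi r) - f rho| <= truncation_bound l C T D r.
Proof.
move=> strho sd s_cvg C0 T0 D0 fL c0; have l0 : forall i, 0 <= l i by case: sd.
have basisP := state_basis strho.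
have l1 i := spectral_weight_le1 i strho sd.
have l_cvg : series l @ \oo --> (1 : R).
  exact: spectral_mass_cvg strho sd.
have eta_l0 i : 0 <= eta (l i) by rewrite eta_ge0// l0 l1.
have seriesD (k : nat -> R) (s : R) : (forall i, 0 <= k i) ->
    series k @ \oo --> s -> forall n, series k n <= s.
  move=> k0 ks n; rewrite -(cvg_lim _ ks)//; apply: nondecreasing_cvgn_le.
    by apply/nondecreasing_seqP => m; rewrite /series /= big_nat_recr//= lerDl.
  by apply/cvg_ex; exists s.
have [S sS] : exists S : R, series (fun i => eta (l i)) @ \oo --> S.
  exact/cvg_ex.
have c1 := seriesD _ _ l0 l_cvg r.
have sr := seriesD _ _ eta_l0 sS r.
have sr0 : 0 <= series (fun i => eta (l i)) r by rewrite /series /= sumr_ge0.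
have S0 : 0 <= S by apply: le_trans sr0 sr.
rewrite /truncation_bound (truncationE r strho sd) (cvg_lim _ sS)//.
move: c0 c1 sr sr0; set c := series l r; set s := series _ r => c0 c1 sr sr0.
have cn0 : c != 0 by rewrite gt_eqF.
(* Used for both the head and the tail: mass 1 makes the operator a state, and a bound on the sum of
   [eta] over its weights bounds its entropy. *)
have spectral_fin A (k : nat -> R) (M : R) : spectral_decomposition A k phi ->
    series k @ \oo --> (1 : R) ->
    (\esum_(i in setT) (eta (k i))%:E <= M%:E)%E ->
    finite_entropy_state A /\ (entropy A <= M%:E)%E.
  move=> sdk k1 kM; have k0 : forall i, 0 <= k i by case: sdk.
  have mass := esum_cvg_series k0 k1.
  have SM : (entropy A <= M%:E)%E.
    by apply: le_trans kM; apply: entropy_le sdk _ => i; exact: esum_ge_term mass.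
  split => //; split; last by apply: le_lt_trans SM _; rewrite ltry.
  exact: spectral_state basisP sdk mass.
have h2_ge0 : 0 <= binary_entropy c.
  by rewrite /binary_entropy addr_ge0// eta_ge0//; lra.
(* When [c = 1] the tail cannot be normalized, but its weights are nonnegative and sum to 0: the
   truncation is [rho] itself, and only the sign of the bound is left to check. *)
have [ceq1|cn1] := eqVneq c 1.
  have -> : (c^-1)%:C *: (projector phi r \o rho) = rho.
    rewrite ceq1 invr1 scale1r; have sdt := spectral_tail r sd ler01.
    have t0 i : 1 * (if (i < r)%N then 0 else l i) = 0 :> R.
      have [tl0 _ _ _] := sdt; apply/eqP; rewrite eq_le tl0 andbT.
      apply: (@esum_ge_term _ _ _ i tl0); rewrite (esum_cvg_series tl0 (cvg_series_tail l_cvg)).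
      by rewrite -/c ceq1 subrr mulr0.
    apply/esym/funext => x; apply/subr0_eq.
    have := spectral_diag_sum (x := x) sdt; rewrite (_ : 1%:C = 1)// scale1r.
    move=> /(cvg_unique (@norm_hausdorff _ _)); apply; apply: cvg_near_cst.
    apply: nearW => n; rewrite /diag_sum /series /= big1// => i _.
    by rewrite t0 mul0r scale0r.
  rewrite subrr normr0; apply: addr_ge0; last first.
    by apply: mulr_ge0 => //; rewrite ceq1 subrr mul0r add0r subr_ge0.
  apply: addr_ge0; first exact: mulr_ge0.
  by rewrite mulr_ge0 ?subr_ge0// mulr_ge0.
have d0 : 0 < 1 - c by rewrite subr_gt0 lt_neqAle cn1.
have dn0 : 1 - c != 0 by rewrite gt_eqF.
have c01 : 0 < c <= 1 by rewrite c0.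
have d01 : 0 < 1 - c <= 1 by rewrite d0; lra.
have ci0 : 0 <= c^-1 by rewrite invr_ge0 ltW.
have di0 : 0 <= (1 - c)^-1 by rewrite invr_ge0 ltW.
set head := _ *: _.
have [headP head_le] : finite_entropy_state head /\ (entropy head <= (c^-1 * S)%:E)%E.
  apply: spectral_fin (spectral_head r sd ci0) _ _.
    by rewrite -(mulVf cn0); exact: cvg_series_head.
  rewrite EFinM -(esum_cvg_series eta_l0 sS) -esumZl//.
  apply: le_esum => i _; rewrite -EFinM lee_fin.
  by case: ifP => _; [exact: eta_scale|rewrite mulr0 eta0 mulr_ge0].
set tail := ((1 - c)^-1)%:C *: (rho - (projector phi r \o rho)).
have [tailP tail_le] : finite_entropy_state tail /\
    (entropy tail <= ((1 - c)^-1 * (S - s))%:E)%E.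
  apply: spectral_fin (spectral_tail r sd di0) _ _.
    by have := @cvg_series_tail _ _ r (1 - c)^-1 _ l_cvg; rewrite -/c mulVf.
  rewrite -(esum_cvg_series _ (@cvg_series_tail _ _ r (1 - c)^-1 _ sS)); last first.
    by move=> i; rewrite mulr_ge0//; case: ifP.
  apply: le_esum => i _; rewrite lee_fin.
  by case: ifP => _; [rewrite !mulr0 eta0|exact: eta_scale].
have c01' : 0 < c < 1 by rewrite c0 lt_neqAle cn1.
have := class_L_mixture fL headP tailP c01'; rewrite -mixtureE// => mixle.
have := class_L_le fL headP (mulr_ge0 ci0 S0) head_le.
have Ss0 : 0 <= S - s by rewrite subr_ge0.
have := class_L_le fL tailP (mulr_ge0 di0 Ss0) tail_le.
move=> /(ler_wpM2l (ltW d0)) fT /(ler_wpM2l (ltW d0)) fH.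
(* As [rho] is the mixture of [head] and [tail] with weight [c], the last bracket is the affinity
   defect, bounded by [D * binary_entropy c]. *)
rewrite (_ : f head - f rho = (1 - c) * f head - (1 - c) * f tail -
  (f rho - c * f head - (1 - c) * f tail)); last by ring.
have := ler_normB ((1 - c) * f head) ((1 - c) * f tail).
rewrite !normrM (ger0_norm (ltW d0)) => HT.
apply: le_trans (ler_normB _ _) _.
rewrite -[leRHS]addrA [leLHS]addrC lerD//.
apply: le_trans HT (le_trans (lerD fH fT) _).
(* An equality: the factor [1 - c] cancels the normalization in the tail entropy bound, and the two
   contributions of [T] add up to [2 * T * (1 - c)]. *)
rewrite le_eqVlt; apply/orP; left; apply/eqP.
by field; rewrite dn0 cn0.
Qed.

End ClassL.

Theorem theorem2 (R : realType) :
  exists Y : (nat -> R) -> R -> R -> R -> nat -> R,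
    forall (H : hilbertType R) (rho : H -> H) (phi : nat -> H) (C T D : R),
      separable H ->
      FA_state rho ->
      spectral_decomposition rho (eigenvalues rho) phi ->
      0 <= C -> 0 <= T -> 0 <= D ->
      (Y (eigenvalues rho) C T D r @[r --> \oo] --> (0 : R)) /\
      exists r0 : nat,
        forall f : (H -> H) -> R, class_L C T D f ->
          forall r : nat, (r0 <= r)%N ->
            `|f (truncation rho phi r) - f rho| <= Y (eigenvalues rho) C T D r.
Proof.
exists (@truncation_bound R) => H rho phi C T D _ [strho [g [g0 lg FA]]] sd C0 T0 D0.
have [l0 _ _ _] := sd.
have s_cvg : cvgn (series (fun i => eta (eigenvalues rho i))).
  apply: (FA_entropy_cvg _ g0 lg FA) => i.
  by rewrite l0 (spectral_weight_le1 i strho sd).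
have l_cvg := spectral_mass_cvg strho sd.
split; first exact: cvg_truncation_bound.
(* From [r0] on, the sum of the first [r] eigenvalues is within distance less than 1 of its limit 1,
   hence positive. This choice depends on neither [f] nor the constants. *)
move/cvgrPdist_lt : l_cvg => /(_ 1 ltr01)[r0 _ r0P]; exists r0 => f fL r r0r.
apply: truncation_le => //.
have := r0P r r0r; rewrite /= => h; have := ler_norm (1 - series (eigenvalues rho) r).
lra.
Qed.
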